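(* There exist two absolute constants $C,c>0$ such that for all integers $d\ge 3$, $n,k\ge1$, all $\alpha\in(0,1)$, all $\epsilon\in(0,\frac12)$ such that $n(1-\epsilon)$ is an integer, all $\alpha$-LDP mechanisms $Q$ and all estimators $\widehat p$, there exists a probability vector $p\in\mathcal P_d$ satisfying $$\mathbb P_p\left[\ \sup_{z'\in\mathcal C(Y)}\big\|\widehat p(z')-p\big\|_1\ \ge\ c\left\{\left(\frac{d}{\alpha\sqrt{kn}}+\frac{\epsilon\sqrt d}{\alpha\sqrt k}\right)\wedge 1\right\}\right]\ \ge\ Ce^{-d}.$$
   Context: Notation: $a\wedge b=\min(a,b)$, $[m]=\{1,\dots,m\}$, $\|x\|_1=\sum_j|x_j|$, and $\mathcal P_d=\{p\in\mathbb R^d: p_j\ge 0\ \forall j,\ \sum_{j=1}^d p_j=1\}$. A Markov transition kernel $Q$ from $[d]$ to a measurable space $(\mathcal Z,\mathcal B)$ is an $\alpha$-locally differentially private ($\alpha$-LDP) mechanism if $\sup_{B\in\mathcal B}\sup_{x,x'\in[d]}\frac{Q(B|x)}{Q(B|x')}\le e^{\alpha}$. For $p\in\mathcal P_d$, $Qp=\sum_{j\in[d]}p_jQ(\cdot|j)$ is the law of $Z$ when $X\sim p$ and $Z|X\sim Q(\cdot|X)$. Put $n'=n(1-\epsilon)$. The clean privatized batches are $Y=(Y^1,\dots,Y^{n'})$ with $Y^b=(Y^b_1,\dots,Y^b_k)$, all $Y^b_l$ being i.i.d. with law $Qp$; $\mathbb P_p$ is the corresponding probability. $\mathcal C(Y)$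 is the set of all families $(Z^b)_{b=1}^n$ of $n$ batches in $\mathcal Z^k$ for which there is $J\subset[n]$ with $|J|=n\epsilon$ and $\{Z^b\}_{b\notin J}=\{Y^1,\dots,Y^{n'}\}$ (equality as collections, with multiplicities). An estimator is a measurable map $\widehat p:\mathcal Z^{nk}\to\mathcal P_d$. ''Absolute constant'' means independent of $d,n,k,\alpha,\epsilon,p,Q,\widehat p$. *)

(* Defs.v *)
From HB Require Import structures.
From mathcomp Require Import all_boot all_order all_algebra.
From mathcomp Require Import all_classical all_reals all_analysis.
Set Implicit Arguments.
Unset Strict Implicit.
Unset Printing Implicit Defensive.
Import Order.TTheory GRing.Theory Num.Theory.
Import numFieldNormedType.Exports.
Local Open Scope classical_set_scope.
Local Open Scope ring_scope.

(* R^d is [d.-tuple R], whose library sigma-algebra (generated by the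
   coordinate maps) is the Borel sigma-algebra of R^d. *)
Definition prob_vectors (R : realType) (d : nat) : set (d.-tuple R) :=
  [set p | (forall j, 0 <= tnth p j) /\ \sum_(j < d) tnth p j = 1].

Definition l1dist (R : realType) (d : nat) (p q : d.-tuple R) : R :=
  \sum_(j < d) `|tnth p j - tnth q j|.

(* As {1..d} carries the discrete sigma-algebra, a Markov kernel from it to Z is
   just a family of probability measures Q j = Q(.|j).  The quotient is the
   extended-real one: a / 0 = +oo for a > 0, and 0 / 0 = 0. *)
Definition LDP (R : realType) (disp : measure_display)
    (Z : measurableType disp) (d : nat) (alpha : R)
    (Q : 'I_d -> probability Z R) : Prop :=
  (ereal_sup [set r | exists B x x',
                measurable B /\ r = Q x B / Q x' B] <= (expR alpha)%:E)%E.

Section mixture.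
Context (R : realType) (disp : measure_display) (Z : measurableType disp).
Context (d : nat) (Q : 'I_d -> probability Z R).
Context (p : d.-tuple R) (hp : prob_vectors p).

Definition mixture_fun of prob_vectors p : set Z -> \bar R :=
  fun B => (\sum_(j < d) (tnth p j)%:E * Q j B)%E.

Local Notation mu := (mixture_fun hp).

Let mu0 : mu set0 = 0%E.
Proof. by rewrite /mixture_fun big1 // => j _; rewrite measure0 mule0. Qed.

Let mu_ge0 B : (0 <= mu B)%E.
Proof.
by apply: sume_ge0 => j _; rewrite mule_ge0 // lee_fin; case: hp => + _; apply.
Qed.

Let mu_sigma_additive : semi_sigma_additive mu.
Proof.
move=> F mF tF mUF; have [p0 _] := hp.
rewrite [X in _ --> X](_ : _ = \sum_(0 <= n <oo) mu (F n))%E.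
  by apply: is_cvg_nneseries => n _ _; exact: mu_ge0.
rewrite /mixture_fun nneseries_sum; last first.
  by move=> j n _; rewrite mule_ge0 // lee_fin.
apply: eq_bigr => j _; rewrite nneseriesZl //; congr (_ * _)%E.
exact: measure_semi_bigcup.
Qed.

HB.instance Definition _ := isMeasure.Build _ _ _ mu mu0 mu_ge0
  mu_sigma_additive.

Let muT : mu setT = 1%E.
Proof.
have [_ p1] := hp.
rewrite /mixture_fun (eq_bigr (fun j => (tnth p j)%:E)); last first.
  by move=> j _; rewrite probability_setT mule1.
by rewrite sumEFin p1.
Qed.

HB.instance Definition _ := Measure_isProbability.Build _ _ _ mu muT.

(* Qp *)
Definition mixture : probability Z R := mu.

End mixture.

Section power.
Context (R : realType) (disp : measure_display) (T : measurableType disp).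

Definition tcons (m : nat) (x : T * m.-tuple T) : m.+1.-tuple T :=
  [tuple of x.1 :: x.2].

Lemma measurable_tcons m : measurable_fun setT (@tcons m).
Proof. by apply: measurable_cons; [exact: measurable_fst|exact: measurable_snd]. Qed.

HB.instance Definition _ m :=
  isMeasurableFun.Build _ _ _ _ (@tcons m) (@measurable_tcons m).

(* The product measure on T^m: the law of m i.i.d. variables with law P. *)
Fixpoint power_prob (P : probability T R) (m : nat) :
    probability (m.-tuple T) R :=
  match m with
  | 0 => dirac ([tuple] : 0.-tuple T)
  | m'.+1 => distribution (P \x power_prob P m')%E (@tcons m')
  end.

Lemma power_prob_rect (P : probability T R) m (A : 'I_m -> set T) :
  (forall i, measurable (A i)) ->
  power_prob P m [set t | forall i, A i (tnth t i)] = (\prod_(i < m) P (A i))%E.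
Proof.
elim: m A => [|m IH] A mA.
  by rewrite big_ord0 /= diracE mem_set // => -[].
rewrite big_ord_recl -IH //= /distribution /pushforward /=.
rewrite -product_measure1E //; last first.
  rewrite (_ : [set t | _] = \bigcap_(i in [set: 'I_m])
      ((fun t : m.-tuple T => tnth t i) @^-1` A (lift ord0 i))); last first.
    by apply/seteqP; split => t /= At i *; apply: At.
  apply: fin_bigcap_measurable => // i _.
  by rewrite -[X in measurable X]setTI; exact: measurable_tnth.
congr (product_measure1 _ _ _); apply/seteqP; split => -[x t] /=.
  move=> At; split; first by have := At ord0; rewrite tnth0.
  by move=> i; have := At (lift ord0 i); rewrite tnthS.
by move=> [Ax At] i; case: (unliftP ord0 i) => [j ->|->]; rewrite ?tnthS ?tnth0.
Qed.

End power.

(* P_p, on families of m batches of size k: the m * k entries are i.i.d. with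
   law Qp. *)
Definition batch_prob (R : realType) (disp : measure_display)
    (Z : measurableType disp) (d : nat) (Q : 'I_d -> probability Z R)
    (m k : nat) (p : d.-tuple R) (hp : prob_vectors p) :
    probability (m.-tuple (k.-tuple Z)) R :=
  power_prob (power_prob (mixture Q hp) k) m.

(* C(Y), with n' = n (1 - eps) *)
Definition contaminations (R : realType) (T : choiceType) (n n' : nat)
    (eps : R) (Y : n'.-tuple T) : set (n.-tuple T) :=
  [set z | exists J : {set 'I_n}, #|J|%:R = n%:R * eps /\
     perm_eq [seq tnth z b | b in ~: J] Y].

(* The event of interest is a union over all contaminations and need not be
   measurable; its probability is understood as the inner probability, which is
   P E for measurable E and is a lower bound for the outer probability. *)
Definition inner_prob (R : realType) (disp : measure_display)
    (T : measurableType disp) (P : probability T R) (E : set T) : \bar R :=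
  ereal_sup [set P A | A in [set A | measurable A /\ A `<=` E]].

(* Main.v *)
Require Import Defs.
From HB Require Import structures.
From mathcomp Require Import all_boot all_order all_algebra.
From mathcomp Require Import all_classical all_reals all_analysis.
From mathcomp Require Import measurable_realfun zify ring lra.
Set Implicit Arguments.
Unset Strict Implicit.
Unset Printing Implicit Defensive.
Import Order.TTheory GRing.Theory Num.Theory.
Import numFieldNormedType.Exports.
Local Open Scope classical_set_scope.
Local Open Scope ring_scope.

(** Two vectors suffice: the uniform vector u, and a vector p obtained from u by
    moving a mass gamma between the two members of each of d/2 disjoint pairs
    of symbols.  Their distance is of order d gamma.  By privacy, each pair
    changes the law of an observation by O(alpha gamma) in the L^2 sense
    relative to Qu, and the directions of the transfers can be chosen so that
    these changes add up no worse than orthogonal vectors ([balanced_signs]):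
    the chi-square divergence of Qp from Qu is O(d alpha^2 gamma^2)
    ([exists_chi2_pair]).  The larger of the two terms of the rate decides how
    large gamma may be.

    First term, gamma of order 1/(alpha sqrt(kn)).  For the sample of all
    clean batches, 1 + chi^2 is at most e^d, so by Cauchy-Schwarz an event of
    probability 1/2 under p keeps probability e^(-d)/4 under u ([chi2_test]).
    No estimate is close to both p and u; hence, already without genuine
    contamination, the error event has probability 1/2 under p or e^(-d)/4
    under u.

    Second term, gamma of order eps/(alpha sqrt(kd)).  The laws of one batch
    under p and u are at total variation distance at most eps/2
    ([chi2_dom_tv]), so ([overlap]) the clean samples under p and u can be
    coupled to differ in at most n eps batches with probability at least 1/2.
    When they do, one family z of n batches contains both samples, so it is a
    contamination of both, and the estimate at z is far from p or from u
    ([contaminated_two_point]).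

    The error event is the projection of a measurable set, so its probability
    has to be bounded from inside.  In the coupling, z is a function of the
    clean sample, of finitely many labels and of variables independent of the
    sample.  The labels are removed by a finite union and the independent
    variables by Fubini: the samples for which z falls in a bad set with
    positive conditional probability form a measurable part of the event
    ([inner_prob_section]).

    Divergences are used through the inequality (E_P g)^2 <= M E_U g^2 for all
    bounded measurable g ([chi2_dom]), which by duality means
    1 + chi^2(P | U) <= M.  In this form no density is ever needed and the
    passage to product measures is an application of Fubini. *)

(** * Means of bounded measurable functions *)

Section bounded_mean.
Context {R : realType}.

(** Bounded measurable functions: integrable for every probability, and stable
    under products and under partial integration. *)
Definition bmf d (T : measurableType d) (g : T -> R) : Prop :=
  measurable_fun setT g /\ exists M, forall x, `|g x| <= M.

Definition mean d (T : measurableType d) (P : probability T R) (g : T -> R) : R :=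
  \int[P]_x g x.

Section one.
Context d (T : measurableType d).
Implicit Types (P Q : probability T R) (g h : T -> R).

Lemma bmf_cst (c : R) : bmf (fun _ : T => c).
Proof. by split; [exact: measurable_cst|exists `|c|]. Qed.

Lemma bmfD g h : bmf g -> bmf h -> bmf (fun x => g x + h x).
Proof.
move=> [mg [M gM]] [mh [N hN]]; split; first exact: measurable_funD.
by exists (M + N) => x; rewrite (le_trans (ler_normD _ _))// lerD.
Qed.

Lemma bmfN g : bmf g -> bmf (fun x => - g x).
Proof.
move=> [mg [M gM]]; split; first exact: measurableT_comp.
by exists M => x; rewrite normrN.
Qed.

Lemma bmfB g h : bmf g -> bmf h -> bmf (fun x => g x - h x).
Proof. by move=> bg bh; apply: bmfD => //; exact: bmfN. Qed.

Lemma bmfM g h : bmf g -> bmf h -> bmf (fun x => g x * h x).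
Proof.
move=> [mg [M gM]] [mh [N hN]]; split; first exact: measurable_funM.
by exists (M * N) => x; rewrite normrM ler_pM.
Qed.

Lemma bmfZ (c : R) g : bmf g -> bmf (fun x => c * g x).
Proof. by move=> bg; apply: bmfM => //; exact: bmf_cst. Qed.

Lemma bmf_sqr g : bmf g -> bmf (fun x => g x ^+ 2).
Proof. by move=> bg; exact: bmfM. Qed.

Lemma bmf_sum n (F : 'I_n -> T -> R) :
  (forall i, bmf (F i)) -> bmf (fun x => \sum_(i < n) F i x).
Proof.
elim: n F => [|n IH] F bF.
  by under eq_fun do rewrite big_ord0; exact: bmf_cst.
by under eq_fun do rewrite big_ord_recl; apply: bmfD => //; exact: IH.
Qed.

Lemma bmf_indic (A : set T) : measurable A -> bmf (\1_A : T -> R).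
Proof.
move=> mA; split; first exact: measurable_indic.
by exists 1 => x; rewrite indicE; case: (_ \in _); rewrite ?normr1 ?normr0.
Qed.

Lemma bmf_integrable P g : bmf g -> P.-integrable setT (EFin \o g).
Proof.
move=> [mg [M gM]]; apply: measurable_bounded_integrable => //.
  by rewrite (le_lt_trans (probability_le1 P _))// ltry.
by exists M; split => [|y My x _]; [exact: num_real|exact: le_trans (ltW My)].
Qed.

Lemma mean_cst P c : mean P (fun _ => c) = c.
Proof. by rewrite /mean Rintegral_cst//= (@probability_setT _ _ _ P) mulr1. Qed.

Lemma meanD P g h : bmf g -> bmf h ->
  mean P (fun x => g x + h x) = mean P g + mean P h.
Proof. by move=> bg bh; rewrite /mean RintegralD//; exact: bmf_integrable. Qed.

Lemma meanB P g h : bmf g -> bmf h ->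
  mean P (fun x => g x - h x) = mean P g - mean P h.
Proof. by move=> bg bh; rewrite /mean RintegralB//; exact: bmf_integrable. Qed.

Lemma meanZ P c g : bmf g -> mean P (fun x => c * g x) = c * mean P g.
Proof. by move=> bg; rewrite /mean RintegralZl//; exact: bmf_integrable. Qed.

Lemma le_mean P g h : bmf g -> bmf h -> (forall x, g x <= h x) ->
  mean P g <= mean P h.
Proof. by move=> bg bh gh; apply: le_Rintegral => //; exact: bmf_integrable. Qed.

Lemma mean_ge0 P g : (forall x, 0 <= g x) -> 0 <= mean P g.
Proof. by move=> g0; exact: Rintegral_ge0. Qed.

Lemma mean_indic P A : measurable A -> mean P \1_A = fine (P A).
Proof. by move=> mA; rewrite /mean /Rintegral integral_indic// setIT. Qed.

Lemma mean_integral P g : bmf g -> ((mean P g)%:E = \int[P]_x (g x)%:E)%E.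
Proof.
move=> bg; rewrite /mean /Rintegral fineK//.
by apply: integrable_fin_num => //; exact: bmf_integrable.
Qed.

Lemma mean_normr P g : bmf g -> `|mean P g| <= mean P (fun x => `|g x|).
Proof. by move=> bg; apply: le_normr_Rintegral => //; exact: bmf_integrable. Qed.

Lemma bmf_normr g : bmf g -> bmf (fun x => `|g x|).
Proof.
move=> [mg [M gM]]; split; first exact: measurableT_comp.
by exists M => x; rewrite normr_id.
Qed.

Lemma mean_mixing n (a : 'I_n -> R) (Q : 'I_n -> probability T R) P g :
  (forall i, 0 <= a i) ->
  (forall A, measurable A -> P A = (\sum_(i < n) (a i)%:E * Q i A)%E) ->
  bmf g -> mean P g = \sum_(i < n) a i * mean (Q i) g.
Proof.
(* adding a constant changes both sides alike, so g may be taken nonnegative *)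
move=> a0 PQ; wlog g0 : g / forall x, 0 <= g x.
  move=> H bg; have [_ [M gM]] := bg.
  have bgM : bmf (fun x => g x + M) by apply: bmfD => //; exact: bmf_cst.
  have gM0 x : 0 <= g x + M.
    by have := gM x; rewrite ler_norml => /andP[? _]; lra.
  have a1 : \sum_(i < n) a i = 1.
    have := PQ setT measurableT; rewrite probability_setT.
    under eq_bigr do rewrite probability_setT mule1.
    by rewrite sumEFin => -[].
  have shift (P' : probability T R) : mean P' (fun x => g x + M) = mean P' g + M.
    by rewrite meanD ?mean_cst//; exact: bmf_cst.
  apply: (addIr M); rewrite -shift H//.
  under eq_bigr do rewrite shift mulrDr.
  by rewrite big_split/= -mulr_suml a1 mul1r.
move=> bg; pose m_ (k : nat) : {measure set T -> \bar R} :=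
  match insub k with
  | Some i => mscale (NngNum (a0 i)) (Q i)
  | None => mzero
  end.
apply: EFin_inj; rewrite mean_integral//.
rewrite (eq_measure_integral (msum m_ n)).
  rewrite ge0_integral_measure_sum//=.
  - rewrite -sumEFin; apply: eq_bigr => i _; rewrite EFinM mean_integral//.
    rewrite /m_ valK ge0_integral_mscale//.
    + by apply/measurable_EFinP; case: bg.
    + by move=> x _; rewrite lee_fin.
  - by move=> x _; rewrite lee_fin.
  - by apply/measurable_EFinP; case: bg.
move=> A mA _; etransitivity; first exact: PQ.
rewrite /msum; apply: eq_bigr => i _.
by rewrite /m_ valK.
Qed.

End one.

Lemma mean_mixture d (T : measurableType d) n (Q : 'I_n -> probability T R)
    (p : n.-tuple R) (hp : prob_vectors p) g : bmf g ->
  mean (mixture Q hp) g = \sum_(i < n) tnth p i * mean (Q i) g.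
Proof. by move=> bg; apply: mean_mixing => //; case: hp. Qed.

Lemma bmf_comp d d' (T : measurableType d) (T' : measurableType d') (f : T -> T')
    (g : T' -> R) : measurable_fun setT f -> bmf g -> bmf (g \o f).
Proof.
by move=> mf [mg [M gM]]; split; [exact: measurableT_comp|exists M => x /=].
Qed.

Section two.
Context d d' (T : measurableType d) (T' : measurableType d').

Lemma bmf_pair (g : T * T' -> R) x : bmf g -> bmf (fun y => g (x, y)).
Proof. by move=> bg; apply: (@bmf_comp _ _ _ _ (pair x) g). Qed.

Lemma mean_prod (P : probability T R) (Q : probability T' R) (g : T * T' -> R) :
  bmf g ->
  bmf (fun x => mean Q (fun y => g (x, y))) /\
  mean (P \x Q)%E g = mean P (fun x => mean Q (fun y => g (x, y))).
Proof.
move=> bg; have ig := bmf_integrable (P \x Q)%E bg.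
have E x : (\int[Q]_y (g (x, y))%:E)%E = (mean Q (fun y => g (x, y)))%:E.
  by rewrite mean_integral//; exact: bmf_pair.
have bF : bmf (fun x => mean Q (fun y => g (x, y))).
  split.
    apply/measurable_EFinP; have := measurable_fubini_F ig.
    by rewrite /fubini_F/=; under eq_fun do rewrite E.
  have [_ [M gM]] := bg; exists M => x.
  rewrite (le_trans (mean_normr _ _))//; first exact: bmf_pair.
  rewrite -[leRHS](mean_cst Q); apply: le_mean => //; last exact: bmf_cst.
  exact/bmf_normr/bmf_pair.
split => //; apply: EFin_inj; rewrite !mean_integral// -(integral12_prod_meas1 ig).
by rewrite /fubini_F/=; under eq_integral do rewrite E.
Qed.

End two.

Section power.
Context d (T : measurableType d).

Lemma bmf_tcons n (g : n.+1.-tuple T -> R) : bmf g ->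
  bmf (fun z : T * n.-tuple T => g (tcons z)).
Proof. by move=> bg; apply: bmf_comp => //; exact: measurable_tcons. Qed.

Lemma mean_power0 (P : probability T R) (g : 0.-tuple T -> R) : bmf g ->
  mean (power_prob P 0) g = g [tuple].
Proof.
move=> [mg _]; rewrite /mean /Rintegral/= integral_dirac//=.
  by rewrite indicE in_setT mul1r.
exact/measurable_EFinP.
Qed.

Lemma mean_powerS (P : probability T R) n (g : n.+1.-tuple T -> R) : bmf g ->
  mean (power_prob P n.+1) g =
  mean P (fun x => mean (power_prob P n) (fun t => g (tcons (x, t)))).
Proof.
move=> bg; have bg' := bmf_tcons bg.
have [_ <-] := mean_prod P (power_prob P n) bg'.
rewrite /mean/=; congr fine; apply: integral_distribution.
  by apply/measurable_EFinP; case: bg.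
exact: bmf_integrable.
Qed.

End power.

End bounded_mean.

(** * Second-moment domination *)

Section chi2.
Context {R : realType}.

(** Dual form of 1 + chi^2(P | U) <= M: the norm in L^2(U) of the density
    dP/dU is the norm of the functional g |-> E_P g. *)
Definition chi2_dom d (T : measurableType d) (P U : probability T R) (M : R) :=
  forall g, bmf g -> mean P g ^+ 2 <= M * mean U (fun x => g x ^+ 2).

Section one.
Context d (T : measurableType d).
Implicit Types (P U : probability T R) (g : T -> R).

Lemma mean_sqr_dev P g : bmf g ->
  mean P (fun x => (g x - mean P g) ^+ 2) =
  mean P (fun x => g x ^+ 2) - mean P g ^+ 2.
Proof.
move=> bg; set m := mean P g.
have -> : (fun x => (g x - m) ^+ 2) =
    (fun x => g x ^+ 2 + ((- (2 * m)) * g x + m ^+ 2)).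
  by apply/funext => x; ring.
have b2 := bmf_sqr bg; have bZ := bmfZ (- (2 * m)) bg.
have bc : bmf (fun _ : T => m ^+ 2) by exact: bmf_cst.
have bs : bmf (fun x => (- (2 * m)) * g x + m ^+ 2) by exact: bmfD.
by rewrite meanD// meanD// meanZ// mean_cst -/m; ring.
Qed.

Lemma mean_sqr_le P g : bmf g -> mean P g ^+ 2 <= mean P (fun x => g x ^+ 2).
Proof.
by move=> bg; rewrite -subr_ge0 -mean_sqr_dev// mean_ge0// => x; exact: sqr_ge0.
Qed.

(** P and U have the same mass, so the difference of the two means does not
    see constants; the hypothesis can thus be applied to the centred function,
    and K multiplies the variance of g only.  This gives 1 + K where a direct
    estimate would give (1 + sqrt K)^2, and the gain is what survives
    taking n-th powers. *)
Lemma chi2_dom_perturb P U K : 0 <= K ->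
  (forall g, bmf g ->
    (mean P g - mean U g) ^+ 2 <= K * mean U (fun x => g x ^+ 2)) ->
  chi2_dom P U (1 + K).
Proof.
move=> K0 H g bg; set m := mean U g.
have bgm : bmf (fun x => g x - m) by apply: bmfB => //; exact: bmf_cst.
have := H _ bgm; rewrite mean_sqr_dev// !meanB ?mean_cst//; try exact: bmf_cst.
rewrite -/m subrr subr0.
set p := mean P g; set V := mean U _ => h.
have mV : m ^+ 2 <= V by exact: mean_sqr_le.
have [K00|Kn0] := eqVneq K 0.
  have /eqP : (p - m) ^+ 2 == 0 by rewrite eq_le sqr_ge0 andbT (le_trans h)// K00 mul0r.
  by move/eqP; rewrite sqrf_eq0 subr_eq0 K00 addr0 mul1r => /eqP ->.
have Kp : 0 < K by rewrite lt_neqAle eq_sym Kn0.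
rewrite -(ler_pM2l Kp).
have := sqr_ge0 (K * m - (p - m)); nra.
Qed.

Lemma chi2_dom_set P U M A : chi2_dom P U M -> measurable A ->
  fine (P A) ^+ 2 <= M * fine (U A).
Proof.
move=> H mA; have := H _ (bmf_indic mA).
rewrite mean_indic//.
have -> : (fun x => \1_A x ^+ 2) = (\1_A : T -> R).
  by apply/funext => x; rewrite indicE; case: (_ \in _); rewrite ?expr0n ?expr1n.
by rewrite mean_indic.
Qed.

(** The factor 1/2 comes from the variance of an indicator, at most 1/4. *)
Lemma chi2_dom_tv P U h A : 0 < h -> chi2_dom P U (1 + h ^+ 2) ->
  measurable A -> `|fine (P A) - fine (U A)| <= h / 2.
Proof.
move=> h0 H mA; set D := fine (P A) - fine (U A); set u := fine (U A) in D *.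
have bA := bmf_indic (R := R) mA.
(* this combination of 1 and the centred indicator of A optimises the bound *)
pose g x : R := D + h ^+ 2 * (\1_A x - u).
have bAu : bmf (fun x => \1_A x - u : R) by apply: bmfB => //; exact: bmf_cst.
have bg : bmf g by apply: bmfD; [exact: bmf_cst|exact: bmfZ].
have := H _ bg.
rewrite meanD ?mean_cst ?meanZ ?meanB ?mean_cst ?mean_indic//;
  try by [exact: bmf_cst|exact: bmfZ]; rewrite -/D.
have -> : mean U (fun x => g x ^+ 2) = D ^+ 2 + h ^+ 4 * (u - u ^+ 2).
  have -> : (fun x => g x ^+ 2) = (fun x =>
      (D ^+ 2 - 2 * D * h ^+ 2 * u + h ^+ 4 * u ^+ 2) +
      (2 * D * h ^+ 2 + h ^+ 4 * (1 - 2 * u)) * \1_A x).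
    by apply/funext => x; rewrite /g indicE; case: (_ \in _) => /=; ring.
  rewrite meanD ?mean_cst ?meanZ ?mean_indic//; try by [exact: bmf_cst|exact: bmfZ].
  rewrite -/u; ring.
move=> H1.
have h2 : 0 < 1 + h ^+ 2 by nra.
have H2 : D ^+ 2 * (1 + h ^+ 2) <= D ^+ 2 + h ^+ 4 * (u - u ^+ 2).
  rewrite -(ler_pM2l h2); nra.
have H3 : D ^+ 2 <= h ^+ 2 * (u - u ^+ 2).
  have h3 : 0 < h ^+ 2 by nra.
  rewrite -(ler_pM2l h3); nra.
have H4 : D ^+ 2 <= (h / 2) ^+ 2 by have := sqr_ge0 (u - 1 / 2); nra.
by rewrite -ler_sqr ?nnegrE ?normr_ge0 ?divr_ge0 ?(ltW h0)// real_normK ?num_real.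
Qed.

(** The inequality for the first coordinate is applied to the partial mean over
    the others, and then the inequality for the others inside the integral. *)
Lemma chi2_dom_power P U M n : 0 <= M -> chi2_dom P U M ->
  chi2_dom (power_prob P n) (power_prob U n) (M ^+ n).
Proof.
move=> M0 H; elim: n => [|n IH] g bg.
  by rewrite expr0 mul1r mean_power0// mean_power0//; exact: bmf_sqr.
have bgt := bmf_tcons bg.
rewrite !mean_powerS//; last exact: bmf_sqr.
have [bm _] := mean_prod P (power_prob P n) bgt.
apply: (le_trans (H _ bm)); rewrite exprS -mulrA; apply: ler_wpM2l => //.
have [bm2 _] := mean_prod P (power_prob U n) (bmf_sqr bgt).
rewrite -meanZ//; apply: le_mean.
- exact: bmf_sqr.
- exact: bmfZ.
- by move=> x; exact: (IH _ (bmf_pair x bgt)).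
Qed.

End one.

(** * Signs that make functionals add up orthogonally *)

Section signs.
Context d (T : measurableType d) (U : probability T R).
Implicit Types (g : T -> R) (a b : (T -> R) -> R).

Definition linear_on_bmf a := forall g h c, bmf g -> bmf h ->
  a (fun x => g x + c * h x) = a g + c * a h.

Definition l2_bounded K a := forall g, bmf g ->
  a g ^+ 2 <= K * mean U (fun x => g x ^+ 2).

Lemma sqrD_le (a b A B p q : R) : 0 <= A -> 0 <= B -> 0 <= p -> 0 <= q ->
  a ^+ 2 <= A * p -> b ^+ 2 <= B * q -> (a + b) ^+ 2 <= (A + B) * (p + q).
Proof.
move=> A0 B0 p0 q0 ha hb.
suff : 2 * (a * b) <= A * q + B * p by nra.
have h0 : 0 <= A * q + B * p by nra.
rewrite (le_trans (ler_norm _))// -ler_sqr ?nnegrE ?normr_ge0// real_normK ?num_real//.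
have : a ^+ 2 * b ^+ 2 <= (A * p) * (B * q) by apply: ler_pM => //; exact: sqr_ge0.
have := sqr_ge0 (A * q - B * p); nra.
Qed.

(** Parallelogram law for dual norms.  If both signs failed, with witnesses g1
    and g2, scale these so that a + b takes on g1 the value that a - b takes on
    g2; the sum of these values is a (g1 + g2) + b (g1 - g2), which
    Cauchy-Schwarz and the parallelogram law for g1 and g2 bound too well. *)
Lemma exists_sign A B a b : 0 <= A -> 0 <= B ->
  linear_on_bmf a -> linear_on_bmf b ->
  l2_bounded A a -> l2_bounded B b ->
  exists s : bool, l2_bounded (A + B) (fun g => a g + (-1) ^+ s * b g).
Proof.
move=> A0 B0 la lb ha hb; apply: contrapT => /forallNP H.
have /existsNP[g1 /not_implyP[bg1 /negP]] := H false.
have /existsNP[g2 /not_implyP[bg2 /negP]] := H true.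
rewrite -!ltNge /= expr0 expr1 mul1r mulN1r.
set y := a g2 - b g2; set x := a g1 + b g1 => h2 h1.
pose p t := y * g1 t + x * g2 t; pose q t := y * g1 t + (- x) * g2 t.
have bp : bmf p by apply: bmfD; exact: bmfZ.
have bq : bmf q by apply: bmfD; exact: bmfZ.
have linZ f (lf : linear_on_bmf f) c c' g g' : bmf g -> bmf g' ->
    f (fun t => c * g t + c' * g' t) = c * f g + c' * f g'.
  move=> bg bg'; rewrite lf//; last exact: bmfZ.
  have b0 := bmf_cst T (0 : R).
  have := lf _ _ c b0 bg; under eq_fun do rewrite add0r.
  move=> ->; have := lf _ _ 1 b0 b0; under eq_fun do rewrite mulr0 addr0.
  lra.
have hap := ha _ bp; have hbq := hb _ bq.
have mp : 0 <= mean U (fun t => p t ^+ 2) by apply: mean_ge0 => t; exact: sqr_ge0.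
have mq : 0 <= mean U (fun t => q t ^+ 2) by apply: mean_ge0 => t; exact: sqr_ge0.
have := sqrD_le A0 B0 mp mq hap hbq.
have -> : a p + b q = 2 * (x * y) by rewrite !linZ// /x /y; ring.
rewrite -meanD; try exact: bmf_sqr.
have -> : (fun t => p t ^+ 2 + q t ^+ 2) =
    (fun t => 2 * y ^+ 2 * g1 t ^+ 2 + 2 * x ^+ 2 * g2 t ^+ 2).
  by apply/funext => t; rewrite /p /q; ring.
rewrite meanD ?meanZ; try by [exact: bmf_sqr|apply/bmfZ/bmf_sqr].
move=> h.
have k1 : 0 <= mean U (fun t => g1 t ^+ 2) by apply: mean_ge0 => t; exact: sqr_ge0.
have k2 : 0 <= mean U (fun t => g2 t ^+ 2) by apply: mean_ge0 => t; exact: sqr_ge0.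
have x0 : 0 < x ^+ 2 by apply: le_lt_trans h1; rewrite mulr_ge0// addr_ge0.
have y0 : 0 < y ^+ 2 by apply: le_lt_trans h2; rewrite mulr_ge0// addr_ge0.
move: h1 h2; rewrite -(ltr_pM2l y0) => h1; rewrite -(ltr_pM2l x0) => h2.
nra.
Qed.

(** An unlucky choice of signs only gives m^2 K.  In L^2, the mean over
    the signs of the squared norm of the sum is the sum of the squared norms;
    here the signs are chosen one by one instead. *)
Lemma balanced_signs K (a : nat -> (T -> R) -> R) m : 0 <= K ->
  (forall i, linear_on_bmf (a i)) -> (forall i, l2_bounded K (a i)) ->
  exists s : nat -> bool,
    l2_bounded (m%:R * K) (fun g => \sum_(i < m) (-1) ^+ s i * a i g).
Proof.
move=> K0 la ha; elim: m => [|m [s hs]].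
  exists (fun=> false) => g bg; rewrite big_ord0 expr0n/= mulr_ge0//.
    by rewrite mul0r.
  by apply: mean_ge0 => t; exact: sqr_ge0.
have lin : linear_on_bmf (fun g => \sum_(i < m) (-1) ^+ s i * a i g).
  move=> g h c bg bh; rewrite mulr_sumr -big_split/=.
  by apply: eq_bigr => i _; rewrite la//; ring.
have mK : 0 <= m%:R * K by rewrite mulr_ge0.
have [e he] := exists_sign mK K0 lin (la m) hs (ha m).
exists (fun i => if i == m then e else s i) => g bg.
rewrite big_ord_recr/= eqxx -natr1 mulrDl mul1r.
under eq_bigr => i _ do rewrite (ltn_eqF (ltn_ord i)).
exact: he.
Qed.

End signs.
End chi2.

(** * Consequences of local differential privacy *)

Section ldp.
Context {R : realType}.

Lemma expR_le_1D3 (x : R) : 0 <= x <= 1 -> expR x <= 1 + 3 * x.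
Proof.
move=> /andP[x0 x1].
have h := expR_ge1Dx (- (x / 2)).
have e : expR (- (x / 2)) ^+ 2 * expR x = 1.
  by rewrite -expRM_natl -expRD -[RHS]expR0; congr expR; rewrite mulr_natl; lra.
have h2 : (1 - x / 2) ^+ 2 <= expR (- (x / 2)) ^+ 2 by rewrite ler_sqr ?nnegrE; lra.
have h3 : (1 - x / 2) ^+ 2 * expR x <= 1 by rewrite -[leRHS]e ler_pM2r ?expR_gt0.
have h4 : 1 <= (1 - x / 2) ^+ 2 * (1 + 3 * x).
  have : 0 <= x * (1 - x) * (8 / 3 - x) by rewrite !mulr_ge0//; lra.
  lra.
have h5 : 0 < (1 - x / 2) ^+ 2 by nra.
by rewrite -(ler_pM2l h5); exact: le_trans h4.
Qed.

Context disp (Z : measurableType disp) (d : nat).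
Implicit Types (Q : 'I_d -> probability Z R) (g : Z -> R).

Lemma LDP_le alpha Q i j B : LDP alpha Q -> measurable B ->
  fine (Q i B) <= expR alpha * fine (Q j B).
Proof.
move=> H mB.
have : (Q i B / Q j B <= (expR alpha)%:E)%E.
  by apply: le_trans H; apply: ereal_sup_ubound; exists B, i, j.
have aE : ((fine (Q i B))%:E = Q i B)%E by rewrite fineK// fin_num_measure.
have bE : ((fine (Q j B))%:E = Q j B)%E by rewrite fineK// fin_num_measure.
have a0 : 0 <= fine (Q i B) by exact: fine_ge0.
have b0 : 0 <= fine (Q j B) by exact: fine_ge0.
rewrite -aE -bE; move: (fine (Q i B)) (fine (Q j B)) a0 b0 {aE bE} => a b a0 b0.
have [->|bn0] := eqVneq b 0.
  rewrite inver eqxx mulr0; have [->//|an0] := eqVneq a 0.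
  by rewrite gt0_muley ?leye_eq// lte_fin lt_neqAle eq_sym an0.
have bp : 0 < b by rewrite lt_neqAle eq_sym bn0.
by rewrite inver (negbTE bn0) -EFinM lee_fin ler_pdivrMr.
Qed.

Lemma LDP_mean alpha Q i j g : LDP alpha Q -> bmf g -> (forall x, 0 <= g x) ->
  mean (Q i) g <= expR alpha * mean (Q j) g.
Proof.
move=> H bg g0.
have mg : measurable_fun setT (EFin \o g) by apply/measurable_EFinP; case: bg.
rewrite -lee_fin EFinM !mean_integral//.
have e0 : 0 <= expR alpha := expR_ge0 _.
rewrite -[X in (X * _)%E]/((NngNum e0)%:num%:E) -ge0_integral_mscale//; last first.
  by move=> x _; rewrite lee_fin.
apply: ge0_le_measure_integral => //.
  move=> S mS; rewrite /= /mscale/= -[X in (X <= _)%E]fineK ?fin_num_measure//.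
  rewrite -[X in (_ <= _ * X)%E]fineK ?fin_num_measure//.
  by rewrite -EFinM lee_fin; exact: LDP_le.
Qed.

(** For nonnegative g the means under the Q j agree up to a factor e^alpha, so
    they differ by O(alpha) times any of their averages; the general case
    follows from positive and negative parts and from Jensen's inequality. *)
Lemma LDP_mean_diff alpha Q i j (p : d.-tuple R) (hp : prob_vectors p) g :
  0 <= alpha <= 1 -> LDP alpha Q -> bmf g ->
  (mean (Q i) g - mean (Q j) g) ^+ 2 <=
    144 * alpha ^+ 2 * mean (mixture Q hp) (fun x => g x ^+ 2).
Proof.
move=> a01 H bg; have [a0 a1] := andP a01; set U := mixture Q hp.
have e3 := expR_le_1D3 a01; have e0 := expR_ge0 alpha.
have pos i' j' f : bmf f -> (forall x, 0 <= f x) ->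
    mean (Q i') f - mean (Q j') f <= 12 * alpha * mean U f.
  move=> bf f0.
  have f0' l : 0 <= mean (Q l) f by exact: mean_ge0.
  have le1 : mean (Q j') f <= expR alpha * mean U f.
    rewrite /U mean_mixture//.
    have [p0 p1] := hp; rewrite -[leLHS]mul1r -p1 mulr_suml mulr_sumr.
    apply: ler_sum => l _; rewrite mulrCA ler_wpM2l//; exact: LDP_mean.
  have le2 : mean (Q i') f <= expR alpha * mean (Q j') f by exact: LDP_mean.
  have U0 : 0 <= mean U f by exact: mean_ge0.
  have le3 : mean (Q j') f <= 4 * mean U f.
    by apply: (le_trans le1); rewrite ler_wpM2r//; lra.
  have le4 : expR alpha * mean (Q j') f <= (1 + 3 * alpha) * mean (Q j') f.
    by rewrite ler_wpM2r.
  have : 3 * alpha * mean (Q j') f <= 3 * alpha * (4 * mean U f).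
    by rewrite ler_wpM2l//; lra.
  lra.
pose gp x := (`|g x| + g x) / 2; pose gn x := (`|g x| - g x) / 2.
have bn := bmf_normr bg.
have bgp : bmf gp.
  rewrite /gp; under eq_fun do rewrite mulrC; apply: bmfZ; exact: bmfD.
have bgn : bmf gn.
  rewrite /gn; under eq_fun do rewrite mulrC; apply: bmfZ; exact: bmfB.
have gp0 x : 0 <= gp x.
  by rewrite divr_ge0//; have := ler_norm (- g x); rewrite normrN; lra.
have gn0 x : 0 <= gn x.
  by rewrite divr_ge0//; have := ler_norm (g x); lra.
have gE : g = (fun x => gp x - gn x) by apply/funext => x; rewrite /gp /gn; lra.
have nE : (fun x => `|g x|) = (fun x => gp x + gn x).
  by apply/funext => x; rewrite /gp /gn; lra.
have mE P : mean P g = mean P gp - mean P gn by rewrite [in LHS]gE meanB.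
have UE : mean U (fun x => `|g x|) = mean U gp + mean U gn by rewrite nE meanD.
have h1 := pos i j _ bgp gp0; have h2 := pos j i _ bgp gp0.
have h3 := pos i j _ bgn gn0; have h4 := pos j i _ bgn gn0.
have h5 : mean U (fun x => `|g x|) ^+ 2 <= mean U (fun x => g x ^+ 2).
  rewrite (le_trans (mean_sqr_le _ bn))//.
  by under eq_fun do rewrite real_normK ?num_real//.
have h6 : `|mean (Q i) g - mean (Q j) g| <= 12 * alpha * mean U (fun x => `|g x|).
  by rewrite ler_norml !mE UE; apply/andP; split; lra.
rewrite -[leLHS]real_normK ?num_real//.
apply: (@le_trans _ _ ((12 * alpha * mean U (fun x => `|g x|)) ^+ 2)).
  by rewrite ler_sqr ?nnegrE ?normr_ge0// (le_trans _ h6).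
rewrite exprMn (_ : (12 * alpha) ^+ 2 = 144 * alpha ^+ 2); last by ring.
by rewrite ler_wpM2l// mulr_ge0// sqr_ge0.
Qed.

End ldp.

(** * The two probability vectors *)

Section two_vectors.
Context {R : realType}.

Lemma sum_by_pairs (G : nat -> R) d : (forall j, (d./2.*2 <= j)%N -> G j = 0) ->
  \sum_(j < d) G j = \sum_(i < d./2) (G i.*2 + G i.*2.+1).
Proof.
move=> G0; rewrite -(big_mkord xpredT G) -{1}(odd_double_half d).
have -> : \sum_(0 <= j < odd d + d./2.*2) G j = \sum_(0 <= j < d./2.*2) G j.
  case: (odd d); rewrite ?add0n// add1n big_nat_recr//= [G _]G0// addr0.
  by [].
elim: d./2 => [|m IH]; first by rewrite big_ord0 big_nil.
by rewrite doubleS !big_nat_recr//= IH big_ord_recr/= addrA.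
Qed.

(** The signs cancel within each pair of symbols, so that adding a multiple of
    this pattern preserves the total mass. *)
Definition paired_signs (d : nat) (s : nat -> bool) (j : nat) : R :=
  if (j < d./2.*2)%N then (-1) ^+ s j./2 * (-1) ^+ odd j else 0.

Lemma sum_paired_signs d s (F : nat -> R) :
  \sum_(j < d) paired_signs d s j * F j =
  \sum_(i < d./2) (-1) ^+ s i * (F i.*2 - F i.*2.+1).
Proof.
rewrite (sum_by_pairs (G := fun j => paired_signs d s j * F j)); last first.
  by move=> j; rewrite /paired_signs ltnNge => ->; rewrite mul0r.
apply: eq_bigr => i _; rewrite /paired_signs ltn_double ltn_ord.
rewrite -doubleS leq_double ltn_ord odd_double /= odd_double doubleK uphalf_double.
by rewrite /= expr0 expr1; ring.
Qed.

Lemma normr_paired_signs d s j :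
  `|paired_signs d s j| = if (j < d./2.*2)%N then 1 else 0.
Proof.
rewrite /paired_signs; case: ifP => _; last by rewrite normr0.
by rewrite normrM !normr_sign mulr1.
Qed.

(** Here u is uniform and p is u + gamma times a sign pattern: the mean of g
    changes by gamma times a signed sum, over the pairs, of the differences of
    the means of g under the Q j.  The 72 is half of the 144 of
    [LDP_mean_diff], there being at most d/2 pairs; the 2/3 accounts for the
    unpaired symbol, the worst case being d = 3. *)
Lemma exists_chi2_pair disp (Z : measurableType disp) d
    (Q : 'I_d -> probability Z R) (alpha gamma : R) :
  (2 <= d)%N -> 0 <= alpha <= 1 -> LDP alpha Q -> 0 <= gamma <= d%:R^-1 ->
  exists (p u : d.-tuple R) (hp : prob_vectors p) (hu : prob_vectors u),
    chi2_dom (mixture Q hp) (mixture Q hu)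
      (1 + gamma ^+ 2 * (72 * d%:R * alpha ^+ 2)) /\
    2 / 3 * (gamma * d%:R) <= l1dist p u.
Proof.
move=> d2 a01 ldp /andP[g0 gd].
have d0 : 0 < d%:R :> R by rewrite ltr0n (leq_trans _ d2).
have j0 : 'I_d by exact: Ordinal (leq_trans (isT : (0 < 2)%N) d2).
pose u : d.-tuple R := [tuple d%:R^-1 | j < d].
have hu : prob_vectors u.
  split => [j|]; first by rewrite tnth_mktuple invr_ge0 ltW.
  under eq_bigr do rewrite tnth_mktuple.
  by rewrite sumr_const card_ord -(mulr_natl _^-1) divff// gt_eqF.
pose a i g := mean (Q (insubd j0 i.*2)) g - mean (Q (insubd j0 i.*2.+1)) g.
have la i : linear_on_bmf (a i).
  move=> g h c bg bh; have bch := bmfZ c bh.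
  by rewrite /a !meanD// !meanZ//; ring.
have ba i : l2_bounded (mixture Q hu) (144 * alpha ^+ 2) (a i).
  by move=> g bg; exact: LDP_mean_diff.
have K0 : 0 <= 144 * alpha ^+ 2 by rewrite mulr_ge0// sqr_ge0.
have [s hs] := balanced_signs d./2 K0 la ba.
pose w := paired_signs d s.
pose p : d.-tuple R := [tuple d%:R^-1 + gamma * w j | j < d].
have hp : prob_vectors p.
  split => [j|].
    rewrite tnth_mktuple.
    have : `|w j| <= 1 by rewrite normr_paired_signs; case: ifP.
    rewrite ler_norml => /andP[w1 _].
    have : gamma * - 1 <= gamma * w j by rewrite ler_wpM2l.
    lra.
  under eq_bigr do rewrite tnth_mktuple.
  rewrite big_split/= sumr_const card_ord -(mulr_natl _^-1) divff ?gt_eqF//.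
  rewrite -mulr_sumr; under eq_bigr do rewrite -[w _]mulr1.
  rewrite (sum_paired_signs d s (fun=> 1)) big1 ?mulr0 ?addr0// => i _.
  by rewrite subrr mulr0.
exists p, u, hp, hu; split.
  apply: chi2_dom_perturb.
    by rewrite mulr_ge0 ?sqr_ge0// mulr_ge0 ?sqr_ge0// mulr_ge0// ltW.
  move=> g bg; rewrite !mean_mixture//; last exact: bmf_sqr.
  have -> : \sum_(i < d) tnth p i * mean (Q i) g - \sum_(i < d) tnth u i * mean (Q i) g
      = gamma * \sum_(i < d./2) (-1) ^+ s i * a i g.
    rewrite -(sum_paired_signs d s (fun j => mean (Q (insubd j0 j)) g)).
    rewrite -sumrB mulr_sumr; apply: eq_bigr => i _.
    rewrite !tnth_mktuple valKd /w; ring.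
  rewrite exprMn -[leRHS]mulrA ler_wpM2l ?sqr_ge0//.
  apply: (le_trans (hs _ bg)); rewrite -mean_mixture; last exact: bmf_sqr.
  apply: ler_wpM2r; first by apply: mean_ge0 => x; exact: sqr_ge0.
  have : (d./2.*2)%:R <= d%:R :> R by rewrite ler_nat -{2}(odd_double_half d) leq_addl.
  rewrite -muln2 natrM => hd.
  have : d./2%:R * 2%:R * (72 * alpha ^+ 2) <= d%:R * (72 * alpha ^+ 2).
    by rewrite ler_wpM2r// mulr_ge0// sqr_ge0.
  lra.
have -> : l1dist p u = gamma * (d./2.*2)%:R.
  have -> : l1dist p u = gamma * \sum_(j < d) `|w j|.
    rewrite /l1dist mulr_sumr; apply: eq_bigr => j _.
    by rewrite !tnth_mktuple addrC addKr normrM ger0_norm.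
  congr (_ * _); rewrite (sum_by_pairs (G := fun j => `|w j|)); last first.
    by move=> j; rewrite normr_paired_signs ltnNge => ->.
  under eq_bigr => i _ do
    rewrite !normr_paired_signs ltn_double -doubleS leq_double ltn_ord.
  rewrite sumr_const card_ord -muln2 natrM -(mulr_natl (_ + _)); ring.
have : 2 / 3 * d%:R <= (d./2.*2)%:R :> R.
  rewrite mulrAC ler_pdivrMr// -!natrM ler_nat.
  have := odd_double_half d; have : (0 < d./2)%N by rewrite half_gt0.
  case: (odd d) => h1 h2; lia.
nra.
Qed.

End two_vectors.

(** * Common part of two probabilities *)

Section overlap.
Context {R : realType} d (T : measurableType d).
Implicit Types (P U : probability T R).

Lemma mean_mixing2 (a b : R) (P Q1 Q2 : probability T R) g : 0 <= a -> 0 <= b ->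
  (forall A, measurable A -> P A = a%:E * Q1 A + b%:E * Q2 A)%E ->
  bmf g -> mean P g = a * mean Q1 g + b * mean Q2 g.
Proof.
move=> a0 b0 h bg.
pose Q (i : 'I_2) := if i == ord0 then Q1 else Q2.
pose c (i : 'I_2) := if i == ord0 then a else b.
rewrite (@mean_mixing _ _ _ 2 c Q)//.
- by rewrite 2!big_ord_recl big_ord0 addr0 /c /Q.
- by move=> i; rewrite /c; case: ifP.
- by move=> A mA; rewrite h// 2!big_ord_recl big_ord0 adde0 /c /Q.
Qed.

(** P0 serves as Q when r is the null measure. *)
Lemma measure_normalized (P0 : probability T R) (r : {measure set T -> \bar R})
    (m : R) : r setT = m%:E ->
  exists Q : probability T R, forall A, measurable A -> r A = (m%:E * Q A)%E.
Proof.
move=> rT; exists (mnormalize r P0) => A mA /=; rewrite /mnormalize rT orbF.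
case: ifPn => [/eqP m0|m0].
  rewrite m0 mul0e; apply/eqP; rewrite eq_le measure_ge0 andbT -m0 -rT.
  by apply: le_measure => //; rewrite inE.
by rewrite muleCA -EFinM divff ?mule1.
Qed.

(** With a Hahn decomposition of P - U, the common part is P on the negative set
    together with U on the positive one; what is left of P and of U are the two
    Jordan parts, both of mass t. *)
Lemma overlap P U t0 :
  (forall A, measurable A -> `|fine (P A) - fine (U A)| <= t0) ->
  exists (t : R) (V X Y : probability T R),
    [/\ 0 <= t <= 1, t <= t0,
        forall g, bmf g -> mean P g = (1 - t) * mean V g + t * mean X g &
        forall g, bmf g -> mean U g = (1 - t) * mean V g + t * mean Y g].
Proof.
move=> PU.
pose nu : {charge set T -> \bar R} :=
  cadd (charge_of_finite_measure P) (cscale (-1) (charge_of_finite_measure U)).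
have [pos [neg H]] := Hahn_decomposition nu.
have [[mp _] [mn _] UT I0] := H.
have fK (Q : probability T R) A : measurable A -> (fine (Q A))%:E = Q A.
  by move=> mA; rewrite fineK// fin_num_measure.
have cut (Q : probability T R) A : measurable A ->
    Q A = (Q (A `&` pos) + Q (A `&` neg))%E.
  move=> mA; rewrite -measureU -?setIUr ?UT ?setIT//.
  - exact: measurableI.
  - exact: measurableI.
  - by rewrite setIACA I0 setI0.
have cE x : cscale (-1) (charge_of_finite_measure U) x = (- U x)%E.
  by rewrite cscaleN1.
have posE A : measurable A ->
    jordan_pos H A = (fine (P (A `&` pos)) - fine (U (A `&` pos)))%:E.
  move=> mA; have mAp := measurableI _ _ mA mp.
  rewrite jordan_posE cjordan_posE /crestr0 mem_set// /crestr/= /cadd.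
  by rewrite EFinB !fK//; congr (_ + _)%E; exact: cE.
have negE A : measurable A ->
    jordan_neg H A = (fine (U (A `&` neg)) - fine (P (A `&` neg)))%:E.
  move=> mA; have mAn := measurableI _ _ mA mn.
  rewrite jordan_negE cjordan_negE /crestr0 mem_set// /crestr/= /cadd.
  rewrite EFinB !fK// [X in (- (_ + X))%E](cE (A `&` neg)).
  by rewrite fin_num_oppeB ?fin_num_measure// addeC.
pose nuc := measure_add (mrestr P mn) (mrestr U mp).
have nucE A : measurable A ->
    nuc A = (fine (P (A `&` neg)) + fine (U (A `&` pos)))%:E.
  move=> mA; rewrite /nuc measure_addE /mrestr/= EFinD !fK//; exact: measurableI.
pose t := fine (P pos) - fine (U pos).
have PT (Q : probability T R) : fine (Q pos) + fine (Q neg) = 1.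
  apply: EFin_inj; rewrite EFinD !fK// -[in RHS](@probability_setT _ _ _ Q).
  by rewrite (cut Q setT)// !setTI.
have t0' : 0 <= t by rewrite -lee_fin; have := posE setT measurableT; rewrite setTI -/t => <-.
have t1 : t <= 1.
  have P1 : fine (P pos) <= 1 by rewrite -lee_fin fK//; exact: probability_le1.
  have U0 : 0 <= fine (U pos) by rewrite fine_ge0.
  by rewrite /t; lra.
have nT : nuc setT = (1 - t)%:E.
  by rewrite nucE// !setTI /t -(PT P); congr EFin; ring.
have pT : jordan_pos H setT = t%:E by rewrite posE// !setTI.
have gT : jordan_neg H setT = t%:E.
  by rewrite negE// !setTI /t; congr EFin; have HP := PT P; have HU := PT U; lra.
have [V VE] := measure_normalized P nT.
have [X XE] := measure_normalized P pT.
have [Y YE] := measure_normalized P gT.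
have VE' A : measurable A ->
    ((1 - t)%:E * V A)%E = (fine (P (A `&` neg)) + fine (U (A `&` pos)))%:E.
  by move=> mA; rewrite -(VE A mA); exact: nucE.
have XE' A : measurable A ->
    (t%:E * X A)%E = (fine (P (A `&` pos)) - fine (U (A `&` pos)))%:E.
  by move=> mA; rewrite -(XE A mA); exact: posE.
have YE' A : measurable A ->
    (t%:E * Y A)%E = (fine (U (A `&` neg)) - fine (P (A `&` neg)))%:E.
  by move=> mA; rewrite -(YE A mA); exact: negE.
exists t, V, X, Y; split.
- by rewrite t0' t1.
- by rewrite (le_trans _ (PU _ mp))// ler_norm.
- move=> g bg; apply: mean_mixing2 => //; first by rewrite subr_ge0.
  move=> A mA; rewrite VE'// XE'// (cut P A)//.
  have mAp := measurableI _ _ mA mp; have mAn := measurableI _ _ mA mn.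
  by rewrite -(fK P _ mAp) -(fK P _ mAn) -!EFinD /=; congr EFin; ring.
- move=> g bg; apply: mean_mixing2 => //; first by rewrite subr_ge0.
  move=> A mA; rewrite VE'// YE'// (cut U A)//.
  have mAp := measurableI _ _ mA mp; have mAn := measurableI _ _ mA mn.
  by rewrite -(fK U _ mAp) -(fK U _ mAn) -!EFinD /=; congr EFin; ring.
Qed.

End overlap.

(** * Joint laws and inner probability *)

Section joint_laws.
Context {R : realType}.

Lemma mean_swap d d' (T : measurableType d) (T' : measurableType d')
    (P : probability T R) (Q : probability T' R) (g : T * T' -> R) : bmf g ->
  mean P (fun x => mean Q (fun y => g (x, y))) =
  mean Q (fun y => mean P (fun x => g (x, y))).
Proof.
move=> bg; have ig := bmf_integrable (P \x Q)%E bg.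
have [_ <-] := mean_prod P Q bg.
have bs : bmf (fun z : T' * T => g (z.2, z.1)).
  apply: (bmf_comp (f := fun z : T' * T => (z.2, z.1)) (g := g)) => //.
  by apply: measurable_fun_pair; [exact: measurable_snd|exact: measurable_fst].
have [bF _] := mean_prod Q P bs.
apply: EFin_inj; rewrite !mean_integral// -(integral21_prod_meas1 ig).
apply: eq_integral => y _; rewrite mean_integral//.
exact: (bmf_pair _ bs).
Qed.

Lemma measurable_map_tuple d d' (T : measurableType d) (T' : measurableType d')
    n (f : T -> T') : measurable_fun setT f ->
  measurable_fun setT (fun t : n.-tuple T => map_tuple f t).
Proof.
move=> mf; apply/measurable_fun_tnthP => i.
rewrite (_ : _ \o _ = f \o (fun t => tnth t i)).
  by apply: measurableT_comp => //; exact: measurable_tnth.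
by apply/funext => t /=; rewrite tnth_map.
Qed.

Lemma map_tcons d d' (T : measurableType d) (T' : measurableType d') n
  (f : T -> T') (x : T) (t : n.-tuple T) :
  map_tuple f (tcons (x, t)) = tcons (f x, map_tuple f t).
Proof. exact: val_inj. Qed.

(** The hypothesis says that f1 and f2 are independent with laws P and Q.  The
    induction peels one position off both samples, which takes one exchange of
    integrals. *)
Lemma mean_power_pair d d1 d2 (W : measurableType d) (T : measurableType d1)
    (T' : measurableType d2) (theta : probability W R) (P : probability T R)
    (Q : probability T' R) (f1 : W -> T) (f2 : W -> T') n
    (g : n.-tuple T * n.-tuple T' -> R) :
  measurable_fun setT f1 -> measurable_fun setT f2 ->
  (forall h, bmf h -> mean theta (fun w => h (f1 w, f2 w)) = mean (P \x Q)%E h) ->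
  bmf g ->
  mean (power_prob theta n) (fun w => g (map_tuple f1 w, map_tuple f2 w)) =
  mean (power_prob P n \x power_prob Q n)%E g.
Proof.
move=> mf1 mf2 H; elim: n g => [|n IH] g bg.
  have [bF ->] := mean_prod (power_prob P 0) (power_prob Q 0) bg.
  rewrite (mean_power0 _ bF) (mean_power0 _ (bmf_pair _ bg)) mean_power0.
    by congr (g (_, _)); exact: val_inj.
  apply: (bmf_comp (f := fun w : 0.-tuple W => (map_tuple f1 w, map_tuple f2 w)) (g := g)) => //.
  by apply: measurable_fun_pair; exact: measurable_map_tuple.
have bgw m g' : bmf g' ->
    bmf (fun w : m.-tuple W => g' (map_tuple f1 w, map_tuple f2 w)).
  move=> bg'.
  apply: (bmf_comp (f := fun w : m.-tuple W => (map_tuple f1 w, map_tuple f2 w)) (g := g')) => //.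
  by apply: measurable_fun_pair; exact: measurable_map_tuple.
rewrite mean_powerS; last exact: bgw.
pose k (z : (T * T') * (n.-tuple T * n.-tuple T')) : R :=
  g (tcons (z.1.1, z.2.1), tcons (z.1.2, z.2.2)).
have bk : bmf k.
  apply: (bmf_comp (f := fun z : (T * T') * (n.-tuple T * n.-tuple T') =>
    (tcons (z.1.1, z.2.1), tcons (z.1.2, z.2.2))) (g := g)) => //.
  by apply: measurable_fun_pair; apply: measurableT_comp;
    try exact: measurable_tcons; apply: measurable_fun_pair;
    apply: measurableT_comp.
have [bh Hh] := mean_prod (P \x Q)%E (power_prob P n \x power_prob Q n)%E bk.
transitivity (mean theta (fun w => (fun yx => mean (power_prob P n \x power_prob Q n)%E
    (fun y => k (yx, y))) (f1 w, f2 w))).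
  congr mean; apply/funext => w /=; rewrite -IH; last exact: (bmf_pair _ bk).
  by congr mean; apply/funext => t; rewrite /k/= !map_tcons.
rewrite (H (fun yx => mean (power_prob P n \x power_prob Q n)%E (fun y => k (yx, y))))//.
have [b1 ->] := mean_prod P Q bh.
have [b2 ->] := mean_prod (power_prob P n.+1) (power_prob Q n.+1) bg.
rewrite mean_powerS//; congr mean; apply/funext => y.
(* k regrouped so that the integrals over x and over Y can be exchanged *)
pose k' (z : (T' * n.-tuple T) * n.-tuple T') : R :=
  k ((y, z.1.1), (z.1.2, z.2)).
have bk' : bmf k'.
  apply: (bmf_comp (f := fun z : (T' * n.-tuple T) * n.-tuple T' =>
    ((y, z.1.1), (z.1.2, z.2))) (g := k)) => //.
  by apply: measurable_fun_pair; apply: measurable_fun_pair => //;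
    apply: measurableT_comp.
have [bk1 _] := mean_prod (Q \x power_prob P n)%E (power_prob Q n) bk'.
transitivity (mean Q (fun x => mean (power_prob P n) (fun Y =>
    mean (power_prob Q n) (fun X => k' ((x, Y), X))))).
  congr mean; apply/funext => x.
  by have [_ ->] := mean_prod (power_prob P n) (power_prob Q n) (bmf_pair (y, x) bk).
rewrite (mean_swap Q (power_prob P n) bk1); congr mean; apply/funext => Y.
by rewrite mean_powerS//; exact: (bmf_pair _ bg).
Qed.

Lemma mean_power_sum d (T : measurableType d) (P : probability T R) n (f : T -> R) :
  bmf f -> mean (power_prob P n) (fun t => \sum_(i < n) f (tnth t i)) =
  n%:R * mean P f.
Proof.
move=> bf; have bt m (i : 'I_m) : bmf (fun t : m.-tuple T => f (tnth t i)).
  apply: (bmf_comp (f := fun t : m.-tuple T => tnth t i) (g := f)) => //.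
  exact: measurable_tnth.
elim: n => [|n IH].
  by under eq_fun do rewrite big_ord0; rewrite mean_cst mul0r.
rewrite mean_powerS; last exact: bmf_sum.
transitivity (mean P (fun x => f x + n%:R * mean P f)).
  congr mean; apply/funext => x; rewrite -IH.
  rewrite -[X in X + _](mean_cst (power_prob P n)) -meanD; last 2 first.
  - exact: bmf_cst.
  - by apply: bmf_sum => i; exact: bt.
  congr mean; apply/funext => t; rewrite big_ord_recl/= tnth0.
  by congr (_ + _); apply: eq_bigr => i _; rewrite tnthS.
rewrite meanD//; last exact: bmf_cst.
by rewrite mean_cst -natr1; ring.
Qed.

(** The x whose section of S has positive Q-probability form a measurable set;
    they belong to E because their section is nonempty, and by Fubini their
    probability is at least that of S. *)
Lemma inner_prob_section d d' (T : measurableType d) (T' : measurableType d')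
    (P : probability T R) (Q : probability T' R) (S : set (T * T')) (E : set T) :
  measurable S -> (forall x y, S (x, y) -> E x) ->
  ((P \x Q) S <= inner_prob P E)%E.
Proof.
move=> mS SE; pose A := [set x | (0 < Q (xsection S x))%E].
have mQ := measurable_fun_xsection Q mS.
have mA : measurable A.
  rewrite -[A]setTI; exact: (emeasurable_fun_o_infty measurableT mQ).
have AE : A `<=` E.
  move=> x; rewrite /A/=; have [[y Sxy] _|/forallNP H] := pselect (exists y, S (x, y)).
    exact: SE Sxy.
  rewrite (_ : xsection S x = set0) ?measure0 ?ltxx//.
  by apply/seteqP; split => // y; rewrite /xsection/= inE => /H.
apply: (@le_trans _ _ (P A)); last by apply: ereal_sup_ubound; exists A.
rewrite /product_measure1 -[leRHS]mul1e -[leRHS]integral_cst//=.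
rewrite [leRHS]integral_mkcond; apply: ge0_le_integral => //.
- by apply/(measurable_restrictT _ mA); exact: measurable_cst.
- move=> x _; rewrite patchE; case: ifPn => [_|].
    exact: probability_le1 (measurable_xsection _ mS).
  by rewrite notin_setE /A/= => /negP; rewrite -leNgt.
Qed.

End joint_laws.

(** * Filling up a sample into a contamination *)

Section contamination.
Context {R : realType}.

(** Any family containing Y as a submultiset is a contamination of Y: J is the
    set of the positions that a matching of z with Y ++ s does not send into
    Y. *)
Lemma contaminations_perm (T : choiceType) (x0 : T) (N n : nat) (eps : R)
    (Y : n.-tuple T) (s : seq T) (z : N.-tuple T) :
  n%:R = N%:R * (1 - eps) -> perm_eq z (Y ++ s) -> contaminations eps Y z.
Proof.
move=> nE; rewrite perm_sym => /(perm_iotaP x0)[is_ pis YE].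
have sis : size is_ = N by rewrite (perm_size pis) size_iota size_tuple.
have uis : uniq is_ by rewrite (perm_uniq pis) iota_uniq.
have snN : (n + size s = N)%N.
  by rewrite -sis -(size_map (nth x0 z) is_) -YE size_cat size_tuple.
(* K is the complement of J *)
pose K := [set i : 'I_N | val i \in take n is_]%SET.
have pK : perm_eq (map val (enum K)) (take n is_).
  apply: uniq_perm.
  - by rewrite map_inj_uniq ?enum_uniq//; exact: val_inj.
  - exact: take_uniq.
  - move=> i; apply/mapP/idP => [[j + ->]|iis].
      by rewrite mem_enum inE.
    have iN : (i < N)%N.
      have := mem_take iis; rewrite (perm_mem pis) mem_iota size_tuple.
      by rewrite add0n.
    by exists (Ordinal iN); rewrite ?mem_enum ?inE.
have cK : #|K| = n.
  rewrite cardE -(size_map val) (perm_size pK) size_takel// sis -snN.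
  exact: leq_addr.
exists (~: K)%SET; split.
  have -> : #|(~: K)%SET| = (N - n)%N.
    by apply/eqP; rewrite -(eqn_add2l n) -{1}cK cardsC card_ord subnKC// -snN leq_addr.
  rewrite natrB; last by rewrite -snN leq_addr.
  by rewrite nE; ring.
rewrite finset.setCK /image_mem.
have -> : [seq tnth z b | b <- enum K] = map (nth x0 z) (map val (enum K)).
  by rewrite -map_comp; apply: eq_map => i /=; rewrite (tnth_nth x0).
have -> : val Y = map (nth x0 z) (take n is_).
  by rewrite map_take -YE take_size_cat// size_tuple.
exact: perm_map.
Qed.

Section fill.
Context (T : pointedType) (n : nat).
Implicit Types (l : n.-tuple bool) (a b Y : n.-tuple T).

(** Reading the list position by position makes [fill] total and, at fixed
    labels l, a choice of coordinates, hence measurable. *)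
Definition fill N l Y a : N.-tuple T :=
  [tuple nth point (Y ++ mask l a) i | i < N].

Definition sel l a b : n.-tuple T :=
  [tuple if tnth l i then tnth a i else tnth b i | i < n].

Lemma fillE N l Y a : (n + count id l <= N)%N ->
  fill N l Y a = Y ++ mask l a ++ nseq (N - (n + count id l)) point :> seq T.
Proof.
move=> nN; have sz : size (Y ++ mask l a) = (n + count id l)%N.
  by rewrite size_cat size_mask !size_tuple.
apply: (@eq_from_nth _ point).
  by rewrite catA size_cat sz size_nseq size_tuple subnKC.
move=> i; rewrite size_tuple => iN.
rewrite -[i]/(val (Ordinal iN)) -tnth_nth tnth_mktuple/= catA [RHS]nth_cat sz.
by case: ltnP => // h; rewrite nth_nseq if_same nth_default// sz.
Qed.

(** At each labelled position the two coupled samples hold a and b, elsewhere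
    they agree.  Adding the labelled entries of the other sample to either one
    gives the same multiset. *)
Lemma perm_sel l a b : perm_eq (sel l a b ++ mask l b) (b ++ mask l a).
Proof.
pose sels (l : seq bool) (a b : seq T) :=
  [seq if w.1 then w.2.1 else w.2.2 | w <- zip l (zip a b)].
have -> : sel l a b = sels l a b :> seq T.
  apply: (@eq_from_nth _ point).
    by rewrite /sels size_tuple size_map !size_zip !size_tuple !minnn.
  move=> i; rewrite size_tuple => iN.
  rewrite -[i in LHS]/(val (Ordinal iN)) -tnth_nth tnth_mktuple.
  rewrite /sels (nth_map (false, (point, point))) ?nth_zip ?size_zip ?size_tuple ?minnn//=.
  by rewrite (tnth_nth false) !(tnth_nth point).
have : size a = size l by rewrite !size_tuple.
have : size b = size l by rewrite !size_tuple.
elim: (val l) (val a) (val b) => [|e l' IH] [|x a'] [|y b']//= [sb] [sa].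
apply/permP => P; have /permP/(_ P) := IH _ _ sb sa.
rewrite /sels !count_cat; case: e => /=; rewrite !count_cat /=; lia.
Qed.

End fill.

End contamination.

(** * Two laws made indistinguishable by contamination *)

Section two_point.
Context {R : realType}.

Lemma mean_bernoulli (t : R) (g : bool -> R) : 0 <= t <= 1 -> bmf g ->
  mean (bernoulli_prob t) g = t * g true + (1 - t) * g false.
Proof.
move=> t01 bg; have [t0 t1] := andP t01.
have md b : mean (dirac b) g = g b.
  by rewrite /mean /Rintegral integral_dirac//= indicE in_setT mul1r.
rewrite (@mean_mixing2 _ _ _ t (1 - t) _ (dirac true) (dirac false))//.
- by rewrite !md.
- by rewrite subr_ge0.
- by move=> A mA; exact: bernoulli_probE.
Qed.

Context d (T : measurableType d) (n : nat).
Implicit Types (P U V X Y : probability T R).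

Lemma measurable_fill N (l : n.-tuple bool) :
  measurable_fun setT (fun z : n.-tuple T * n.-tuple T => fill N l z.1 z.2).
Proof.
apply/measurable_fun_tnthP => i.
have mnth (j : nat) : measurable_fun setT (fun t : n.-tuple T => nth point t j).
  have [jn|nj] := ltnP j n.
    rewrite (_ : (fun _ => _) = (fun t => tnth t (Ordinal jn))).
      exact: measurable_tnth.
    by apply/funext => t; rewrite (tnth_nth point).
  rewrite (_ : (fun _ => _) = cst point); first exact: measurable_cst.
  by apply/funext => t; rewrite nth_default// size_tuple.
pose is_ := mask l (iota 0 n).
have maskE (t : n.-tuple T) : mask l t = [seq nth point t j | j <- is_].
  rewrite /is_ map_mask; congr mask.
  by rewrite -[LHS](mkseq_nth point) size_tuple.
rewrite (_ : _ \o _ = fun z : n.-tuple T * n.-tuple T => if (i < n)%N then nth point z.1 i else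
    if (i - n < size is_)%N then nth point z.2 (nth 0%N is_ (i - n)) else point).
  have [_|_] := ltnP i n; first exact: (measurableT_comp (mnth _)).
  have [_|_] := ltnP (i - n)%N (size is_); last exact: measurable_cst.
  exact: (measurableT_comp (mnth _)).
apply/funext => z /=; rewrite tnth_mktuple nth_cat size_tuple.
case: ifP => // _; rewrite maskE; case: ifP => h.
  by rewrite (nth_map 0%N).
by rewrite nth_default// size_map leqNgt h.
Qed.

Lemma measurable_sel (l : n.-tuple bool) :
  measurable_fun setT (fun z : n.-tuple T * n.-tuple T => sel l z.1 z.2).
Proof.
apply/measurable_fun_tnthP => i.
rewrite (_ : _ \o _ = fun z : n.-tuple T * n.-tuple T => if tnth l i then tnth z.1 i else tnth z.2 i).
  by have [|] := boolP (tnth l i) => _; apply: (measurableT_comp (measurable_tnth i)).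
by apply/funext => z /=; rewrite tnth_mktuple.
Qed.

(** One position of the coupling is (l, (v, (x, y))), with independent entries:
    a Bernoulli(t) label l, a draw v of the common part, and draws x and y of
    the parts of P and U that are left.  The clean batch is x under P and y
    under U if l is true, and v otherwise.  The family z adds to the sample
    of P the labelled y, equivalently to the sample of U the labelled x.  Given
    the labels, what is added to a sample is independent of it, which is what
    [inner_prob_section] needs.  By Markov's inequality for the number of true
    labels, whose mean is at most N eps / 2, the added entries fit in with
    probability at least 1/2. *)
Lemma contaminated_two_point N (eps : R) P U (AP AU : set (N.-tuple T)) :
  (0 < N)%N -> 0 < eps -> n%:R = N%:R * (1 - eps) ->
  (forall A, measurable A -> `|fine (P A) - fine (U A)| <= eps / 2) ->
  measurable AP -> measurable AU -> (forall z, AP z \/ AU z) ->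
  ((1 / 2)%:E <=
    inner_prob (power_prob P n)
      [set Y | exists2 z, contaminations eps Y z & AP z] +
    inner_prob (power_prob U n)
      [set Y | exists2 z, contaminations eps Y z & AU z])%E.
Proof.
move=> N0 e0 nE PU mAP mAU APU.
have [t [V [X [Y [t01 te HP HU]]]]] := overlap PU.
have [t0 t1] := andP t01.
have nN : (n <= N)%N.
  by rewrite -(ler_nat R) nE; have : 0 <= N%:R :> R by []; nra.
pose m := (N - n)%N.
have mE : m%:R = N%:R * eps :> R by rewrite natrB// nE; ring.
have m0 : 0 < m%:R :> R by rewrite mE mulr_gt0// ltr0n.
pose theta : probability _ R := (bernoulli_prob t \x (V \x (X \x Y)))%E.
pose W := (bool * (T * (T * T)))%type.
pose lab (w : W) := w.1.
pose px (w : W) := w.2.2.1.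
pose py (w : W) := w.2.2.2.
pose c1 (w : W) := if lab w then px w else w.2.1.
pose c2 (w : W) := if lab w then py w else w.2.1.
have mlab : measurable_fun setT lab by exact: measurable_fst.
have mpx : measurable_fun setT px.
  by apply: measurableT_comp => //; apply: measurableT_comp.
have mpy : measurable_fun setT py.
  by apply: measurableT_comp => //; apply: measurableT_comp.
have mv : measurable_fun setT (fun w : W => w.2.1) by apply: measurableT_comp.
have mc1 : measurable_fun setT c1 by exact: measurable_fun_ifT.
have mc2 : measurable_fun setT c2 by exact: measurable_fun_ifT.
have thetaE g : bmf g -> mean theta g =
    t * mean V (fun v => mean X (fun x => mean Y (fun y => g (true, (v, (x, y))))))
    + (1 - t) * mean V (fun v => mean X (fun x => mean Y (fun y => g (false, (v, (x, y)))))).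
  move=> bg.
  have [b1 ->] := mean_prod (bernoulli_prob t) (V \x (X \x Y))%E bg.
  rewrite mean_bernoulli//.
  have E b : mean (V \x (X \x Y))%E (fun y => g (b, y)) =
      mean V (fun v => mean X (fun x => mean Y (fun y => g (b, (v, (x, y)))))).
    have bb := bmf_pair b bg.
    have [_ ->] := mean_prod V (X \x Y)%E bb; congr mean; apply/funext => v.
    by have [_ ->] := mean_prod X Y (bmf_pair v bb).
  by rewrite !E.
have law1 h : bmf h -> mean theta (fun w => h (c1 w, py w)) = mean (P \x Y)%E h.
  move=> bh; rewrite thetaE; last first.
    apply: (bmf_comp (f := fun w : W => (c1 w, py w)) (g := h)) => //.
    exact: measurable_fun_pair.
  rewrite /c1 /lab /px /py/=.
  have [b1 ->] := mean_prod P Y bh; rewrite HP// mean_cst addrC.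
  by congr (_ * mean _ _ + _); apply/funext => v; rewrite mean_cst.
have law2 h : bmf h -> mean theta (fun w => h (c2 w, px w)) = mean (U \x X)%E h.
  move=> bh; rewrite thetaE; last first.
    apply: (bmf_comp (f := fun w : W => (c2 w, px w)) (g := h)) => //.
    exact: measurable_fun_pair.
  rewrite /c2 /lab /px /py/=.
  have [b1 ->] := mean_prod U X bh; rewrite HU// mean_cst addrC.
  rewrite -(mean_swap Y X bh).
  congr (_ * mean _ _ + _).
  by apply/funext => v; congr mean; apply/funext => x; rewrite mean_cst.
(* the labels are quantified away: they depend on the clean sample *)
pose ok := [set l : n.-tuple bool | (count id l <= m)%N].
pose SP := \bigcup_(l in ok) ((fun z => fill N l z.1 z.2) @^-1` AP).
pose SU := \bigcup_(l in ok) ((fun z => fill N l (sel l z.2 z.1) z.1) @^-1` AU).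
have mSP : measurable SP.
  apply: fin_bigcup_measurable => // l _; rewrite -[X in measurable X]setTI.
  exact: measurable_fill.
have mSU : measurable SU.
  apply: fin_bigcup_measurable => // l _; rewrite -[X in measurable X]setTI.
  have mf : measurable_fun setT (fun z : n.-tuple T * n.-tuple T => (sel l z.2 z.1, z.1)).
    apply: measurable_fun_pair => //.
    apply: (measurableT_comp (measurable_sel l) (g := fun z => (z.2, z.1))).
    exact: measurable_fun_pair.
  by apply: (measurableT_comp (measurable_fill l) mf).

have le1 : ((mean (power_prob P n \x power_prob Y n)%E \1_SP)%:E <=
    inner_prob (power_prob P n)
      [set Y | exists2 z, contaminations eps Y z & AP z])%E.
  rewrite mean_indic// fineK ?fin_num_measure//.
  apply: inner_prob_section => // y x [l /= lm APz].
  exists (fill N l y x) => //.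
  apply: (contaminations_perm point (s := mask l x ++ nseq (N - (n + count id l)) point)) => //.
  by rewrite fillE// -leq_subRL.
have le2 : ((mean (power_prob U n \x power_prob X n)%E \1_SU)%:E <=
    inner_prob (power_prob U n)
      [set Y | exists2 z, contaminations eps Y z & AU z])%E.
  rewrite mean_indic// fineK ?fin_num_measure//.
  apply: inner_prob_section => // y x [l /= lm AUz].
  exists (fill N l (sel l x y) y) => //.
  apply: (contaminations_perm point (s := mask l x ++ nseq (N - (n + count id l)) point)) => //.
  by rewrite fillE -?leq_subRL// !catA perm_cat2r perm_sel.
have b1 := bmf_indic (R := R) mSP; have b2 := bmf_indic (R := R) mSU.
have bt (f1 f2 : W -> T) (g : n.-tuple T * n.-tuple T -> R) :
    measurable_fun setT f1 -> measurable_fun setT f2 -> bmf g ->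
    bmf (fun w : n.-tuple W => g (map_tuple f1 w, map_tuple f2 w)).
  move=> mf1 mf2 bg.
  apply: (bmf_comp (f := fun w : n.-tuple W => (map_tuple f1 w, map_tuple f2 w)) (g := g)) => //.
  by apply: measurable_fun_pair; exact: measurable_map_tuple.
pose f (w : W) : R := (lab w)%:R.
have bf : bmf f.
  by apply: (bmf_comp (f := lab) (g := fun b : bool => b%:R)) => //; split => //;
    exists 1 => -[]; rewrite ?normr0 ?normr1.
have mf : mean theta f = t.
  by rewrite thetaE// /f /lab/= !mean_cst mulr1 mulr0 addr0.
have bfs : bmf (fun w : n.-tuple W => \sum_(i < n) f (tnth w i)).
  apply: bmf_sum => i.
  apply: (bmf_comp (f := fun w : n.-tuple W => tnth w i) (g := f)) => //.
  exact: measurable_tnth.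
have cntE (w : n.-tuple W) :
    \sum_(i < n) f (tnth w i) = (count id (map_tuple lab w))%:R.
  rewrite -sum1_count [in RHS]big_map [in RHS]big_tuple [in RHS]big_mkcond/= natr_sum.
  by apply: eq_bigr => i _; rewrite /f; case: (lab _).
(* if too many labels are true, the last term alone reaches 1 *)
have key (w : n.-tuple W) : 1 <=
    (\1_SP (map_tuple c1 w, map_tuple py w) + \1_SU (map_tuple c2 w, map_tuple px w))
    + m%:R^-1 * \sum_(i < n) f (tnth w i).
  rewrite cntE; set l := map_tuple lab w.
  have [lm|ml] := leqP (count id l) m; last first.
    apply: (@le_trans _ _ (m%:R^-1 * (count id l)%:R)).
      by rewrite mulrC ler_pdivlMr// mul1r ler_nat ltnW.
    by rewrite lerDr addr_ge0// indicE.
  have i0 : 0 <= m%:R^-1 * (count id l)%:R :> R by rewrite mulr_ge0// invr_ge0.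
  have fillE' : fill N l (sel l (map_tuple px w) (map_tuple c2 w)) (map_tuple c2 w)
      = fill N l (map_tuple c1 w) (map_tuple py w).
    have sE : sel l (map_tuple px w) (map_tuple c2 w) = map_tuple c1 w.
      apply: eq_from_tnth => i; rewrite tnth_mktuple !tnth_map /c1 /c2.
      by case: (lab _).
    rewrite sE; apply: eq_from_tnth => i; rewrite !tnth_mktuple.
    congr (nth _ (_ ++ _) _); rewrite /l/=.
    elim: (val w) => //= v s ->; rewrite /c2.
    by case: (lab v).
  have [H|H] := APU (fill N l (map_tuple c1 w) (map_tuple py w)).
    have -> : \1_SP (map_tuple c1 w, map_tuple py w) = 1 :> R.
      by rewrite indicE mem_set//; exists l.
    by rewrite -addrA lerDl addr_ge0// indicE.
  have -> : \1_SU (map_tuple c2 w, map_tuple px w) = 1 :> R.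
    by rewrite indicE mem_set//; exists l => //=; rewrite fillE'.
  by rewrite addrAC lerDr addr_ge0// indicE.
have b1' := bt c1 py _ mc1 mpy b1; have b2' := bt c2 px _ mc2 mpx b2.
have bfz := bmfZ m%:R^-1 bfs.
have := le_mean (power_prob theta n) (bmf_cst _ 1) (bmfD (bmfD b1' b2') bfz) key.
rewrite mean_cst meanD//; last exact: bmfD.
rewrite (meanD _ b1' b2') meanZ// mean_power_sum// mf.
rewrite (mean_power_pair mc1 mpy law1 b1) (mean_power_pair mc2 mpx law2 b2).
have h1 : m%:R^-1 * (n%:R * t) <= 1 / 2.
  rewrite mulrC ler_pdivrMr// mE.
  have a1 : n%:R * t <= n%:R * (eps / 2) by rewrite ler_wpM2l.
  have a2 : n%:R * (eps / 2) <= N%:R * (eps / 2).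
    by rewrite ler_wpM2r ?ler_nat// divr_ge0// ltW.
  by apply: (le_trans a1); apply: (le_trans a2); rewrite (_ : 1 / 2 * _ = N%:R * (eps / 2))//; field.
move=> h2; apply: le_trans (leeD le1 le2).
rewrite -EFinD lee_fin; set u := mean _ _ + _ in h2 *.
move: (_ * _) h1 h2; clear; move=> a; lra.
Qed.
End two_point.

(** * Testing between the two vectors *)

Section testing.
Context {R : realType}.

Lemma l1dist_triangle d (p q r : d.-tuple R) :
  l1dist p q <= l1dist r p + l1dist r q.
Proof.
rewrite /l1dist -big_split/=; apply: ler_sum => j _.
by rewrite (distrC (tnth r j)) ler_distD.
Qed.

Lemma measurable_l1dist disp (T : measurableType disp) d (f : T -> d.-tuple R) q :
  measurable_fun setT f -> measurable_fun setT (fun z => l1dist (f z) q).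
Proof.
move=> mf; apply: measurable_sum => j.
apply: measurableT_comp => //; apply: measurable_funB; last exact: measurable_cst.
by apply: (measurableT_comp (measurable_tnth j)).
Qed.

Lemma inner_probS disp (T : measurableType disp) (P : probability T R) (E F : set T) :
  E `<=` F -> (inner_prob P E <= inner_prob P F)%E.
Proof.
move=> EF; apply: ereal_sup_le => _ [A [mA AE] <-].
by exists A => //; split => //; exact: subset_trans EF.
Qed.

Lemma inner_prob_ge disp (T : measurableType disp) (P : probability T R) (A E : set T) :
  measurable A -> A `<=` E -> (P A <= inner_prob P E)%E.
Proof. by move=> mA AE; apply: ereal_sup_ubound; exists A. Qed.

(** If P gives A less than 1/2, it gives the complement more than 1/2, and
    [chi2_dom_set] carries this over to U. *)
Lemma chi2_test disp (T : measurableType disp) (P U : probability T R) M A :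
  chi2_dom P U M -> measurable A ->
  1 / 2 <= fine (P A) \/ 1 / 4 <= M * fine (U (~` A)).
Proof.
move=> H mA; have [|lt12] := leP (1 / 2) (fine (P A)); first by left.
right; apply: le_trans (chi2_dom_set H (measurableC mA)).
have -> : fine (P (~` A)) = 1 - fine (P A).
  by rewrite probability_setC// fineB ?fin_num_measure.
nra.
Qed.

Lemma expr_1D_le (x : R) n : 0 <= x -> (1 + x) ^+ n <= expR (n%:R * x).
Proof.
by move=> x0; rewrite expRM_natl lerXn2r ?nnegrE ?expR_ge0 ?addr_ge0// expR_ge1Dx.
Qed.

Lemma expR_half_le (x : R) : 0 <= x <= 1 -> expR (x / 2) <= 1 + x.
Proof.
move=> /andP[x0 x1].
have h := expR_ge1Dx (- (x / 2)).
have e : expR (- (x / 2)) * expR (x / 2) = 1 by rewrite -expRD addNr expR0.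
have e0 := expR_gt0 (x / 2).
have h1 : (1 - x / 2) * expR (x / 2) <= 1 by rewrite -[leRHS]e ler_pM2r.
have h2 : 1 <= (1 - x / 2) * (1 + x) by nra.
have h3 : 0 < 1 - x / 2 by lra.
by rewrite -(ler_pM2l h3); exact: le_trans h2.
Qed.

Lemma contaminations_fill disp (T : measurableType disp) N n (eps : R)
    (Y : n.-tuple T) : n%:R = N%:R * (1 - eps) -> (n <= N)%N ->
  contaminations eps Y (fill N [tuple of nseq n false] Y Y).
Proof.
move=> nE nN; apply: (contaminations_perm point
  (s := mask (nseq n false) Y ++ nseq (N - (n + count id (nseq n false))) point)) => //.
by rewrite fillE ?count_nseq ?mul0n ?addn0.
Qed.

End testing.

Theorem proposition3 (R : realType) :
  exists C c : R, 0 < C /\ 0 < c /\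
  forall (d n k n' : nat) (alpha eps : R)
    (disp : measure_display) (Z : measurableType disp)
    (Q : 'I_d -> probability Z R)
    (phat : n.-tuple (k.-tuple Z) -> d.-tuple R),
  (3 <= d)%N -> (1 <= n)%N -> (1 <= k)%N ->
  0 < alpha < 1 -> 0 < eps < 1 / 2 ->
  n'%:R = n%:R * (1 - eps) ->
  LDP alpha Q ->
  measurable_fun setT phat ->
  (forall z, prob_vectors (phat z)) ->
  exists (p : d.-tuple R) (hp : prob_vectors p),
  ((C * expR (- d%:R))%:E <=
   inner_prob (batch_prob Q n' k hp)
     [set Y | (c * Num.min (d%:R / (alpha * Num.sqrt (k%:R * n%:R)) +
                            eps * Num.sqrt d%:R / (alpha * Num.sqrt k%:R)) 1)%:E
              <= ereal_sup [set (l1dist (phat z) p)%:E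
                           | z in contaminations eps Y]])%E.
Proof.
exists (1 / 4), (1 / 72); do 2 split => //.
move=> d n k n' alpha eps disp Z Q phat d3 n1 k1 /andP[a0 a1] /andP[e0 e12] nE ldp mphat _.
set r1 := d%:R / _; set r2 := eps * _ / _; set thr := 1 / 72 * _.
have d0 : 0 < d%:R :> R by rewrite ltr0n (leq_trans _ d3).
have n0 : 0 < n%:R :> R by rewrite ltr0n.
have k0 : 0 < k%:R :> R by rewrite ltr0n.
have nn : (n' <= n)%N.
  by rewrite -(ler_nat R) nE; nra.
have r10 : 0 < r1 by rewrite divr_gt0// mulr_gt0// sqrtr_gt0 mulr_gt0.
have r20 : 0 < r2 by rewrite divr_gt0// mulr_gt0// sqrtr_gt0.
pose r := Num.max r1 r2.
(* by the definition of r, the bound r / (12 d) is 1 / (12 alpha sqrt(kn)) or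
   eps / (12 alpha sqrt(kd)); the bound 1 / d keeps p nonnegative *)
pose gamma := Num.min (r / 12) 1 / d%:R.
have r0 : 0 < r by rewrite lt_max r10.
have g0 : 0 <= gamma.
  by rewrite divr_ge0 ?(ltW d0)// le_min ler01 andbT divr_ge0// ltW.
have g1 : gamma <= d%:R^-1.
  by rewrite /gamma ler_pdivrMr// mulVf ?gt_eqF// ge_min lexx orbT.
have gr : gamma <= r / (12 * d%:R).
  by rewrite /gamma invfM mulrA ler_pM2r ?invr_gt0// ge_min lexx.
have a01 : 0 <= alpha <= 1 by rewrite (ltW a0) (ltW a1).
have g01 : 0 <= gamma <= d%:R^-1 by rewrite g0 g1.
have [p [u [hp [hu [dom dist]]]]] := exists_chi2_pair (ltnW d3) a01 ldp g01.
set chi := gamma ^+ 2 * _ in dom.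
have chi0 : 0 <= chi.
  apply: mulr_ge0; first exact: sqr_ge0.
  by apply: mulr_ge0; [apply: mulr_ge0|exact: sqr_ge0].
have chiE : chi <= r ^+ 2 * alpha ^+ 2 / (2 * d%:R).
  have -> : r ^+ 2 * alpha ^+ 2 / (2 * d%:R) =
      (r / (12 * d%:R)) ^+ 2 * (72 * d%:R * alpha ^+ 2) by field; lra.
  rewrite /chi ler_pM2r; last by rewrite !mulr_gt0// exprn_gt0.
  by rewrite ler_sqr// nnegrE divr_ge0 ?mulr_ge0 ?ltW.
have sep : 2 * thr <= l1dist p u.
  apply: le_trans dist; rewrite /gamma mulfVK ?gt_eqF// /thr.
  have rr : r1 + r2 <= 2 * r.
    have r1r : r1 <= r by rewrite le_max lexx.
    have r2r : r2 <= r by rewrite le_max lexx orbT.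
    lra.
  have mm : Num.min (r1 + r2) 1 <= 24 * Num.min (r / 12) 1.
    have [h|h] := leP (r / 12) 1; last by rewrite ge_min; apply/orP; right; lra.
    by rewrite ge_min; apply/orP; left; lra.
  lra.
(* thr is at most half the distance from p to u, so every z is in A p or A u *)
pose A (q : d.-tuple R) := [set z | thr <= l1dist (phat z) q].
have mA q : measurable (A q).
  rewrite -[A q]setTI.
  have := measurable_l1dist q mphat measurableT (measurable_itv `[thr, +oo[).
  by congr measurable; apply/seteqP; split => z /=; rewrite in_itv/= andbT.
have Apu z : A p z \/ A u z.
  have tri := l1dist_triangle p u (phat z); rewrite /A/=.
  have [h1|h1] := leP thr (l1dist (phat z) p); first by left.
  have [h2|h2] := leP thr (l1dist (phat z) u); first by right.
  lra.
have evS q : [set Y : n'.-tuple _ | exists2 z, contaminations eps Y z & A q z] `<=`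
    [set Y | (thr%:E <= ereal_sup [set (l1dist (phat z) q)%:E | z in contaminations eps Y])%E].
  move=> Y [z zY Az] /=; apply: le_trans (ereal_sup_ubound _ ); last by exists z.
  by rewrite lee_fin.
have ed : expR (- d%:R) <= 1 :> R by rewrite -[leRHS]expR0 ler_expR oppr_le0 ltW.
have ed0 := expR_gt0 (- d%:R : R).
have domk := chi2_dom_power (n := k) (addr_ge0 ler01 chi0) dom.
have [r12|r21] := leP r2 r1.
(* first term of the rate dominant: z is the clean sample, padded *)
- have rE : r = r1 by rewrite /r max_l.
  have domn := chi2_dom_power (n := n') (exprn_ge0 k (addr_ge0 ler01 chi0)) domk.
  set M := (_ ^+ n') in domn.
  have MM : M <= expR d%:R.
    rewrite /M -exprM (le_trans (expr_1D_le _ chi0))// ler_expR.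
    have r1E : r1 ^+ 2 * alpha ^+ 2 * (k%:R * n%:R) = d%:R ^+ 2.
      have sq : Num.sqrt (k%:R * n%:R) ^+ 2 = k%:R * n%:R :> R.
        by rewrite sqr_sqrtr// mulr_ge0 ?ltW.
      have s0 : 0 < Num.sqrt (k%:R * n%:R) :> R by rewrite sqrtr_gt0 mulr_gt0.
      rewrite /r1; move: (Num.sqrt _) sq s0 => s <- s0; field.
      by rewrite !gt_eqF.
    have h : chi * (k%:R * n%:R) <= d%:R.
      apply: (@le_trans _ _ (r ^+ 2 * alpha ^+ 2 / (2 * d%:R) * (k%:R * n%:R))).
        by rewrite ler_pM2r ?mulr_gt0.
      rewrite rE mulrAC r1E ler_pdivrMr ?mulr_gt0//; nra.
    apply: le_trans h; rewrite mulrC ler_wpM2l// natrM ler_wpM2l ?ler_nat//.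
  pose B := (fun Y : n'.-tuple (k.-tuple Z) => fill n [tuple of nseq n' false] Y Y) @^-1` A p.
  have mB : measurable B.
    rewrite /B -[X in measurable X]setTI.
    apply: (measurableT_comp (measurable_fill _) (g := fun Y => (Y, Y))) => //.
    exact: measurable_fun_pair.
  have [h|h] := chi2_test domn mB.
    exists p, hp; apply: (@le_trans _ _ (batch_prob Q n' k hp B)).
      rewrite -[leRHS]fineK ?fin_num_measure// lee_fin.
      apply: le_trans h; lra.
    apply: inner_prob_ge => // Y BY; apply: evS; exists (fill n [tuple of nseq n' false] Y Y) => //.
    exact: contaminations_fill.
  exists u, hu; apply: (@le_trans _ _ (batch_prob Q n' k hu (~` B))).
    rewrite -[leRHS]fineK ?fin_num_measure//; last exact: measurableC.
    rewrite lee_fin expRN ler_pdivrMr ?expR_gt0// (le_trans h)// mulrC.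
    by rewrite ler_wpM2l// fine_ge0.
  apply: inner_prob_ge; first exact: measurableC.
  move=> Y nBY; apply: evS; exists (fill n [tuple of nseq n' false] Y Y).
    exact: contaminations_fill.
  by have [] := Apu (fill n [tuple of nseq n' false] Y Y).
(* second term of the rate dominant: genuine contamination *)
- have rE : r = r2 by rewrite /r max_r// ltW.
  have r2E : r2 ^+ 2 * alpha ^+ 2 * k%:R = eps ^+ 2 * d%:R.
    have sq : Num.sqrt k%:R ^+ 2 = k%:R :> R by rewrite sqr_sqrtr// ltW.
    have sqd : Num.sqrt d%:R ^+ 2 = d%:R :> R by rewrite sqr_sqrtr// ltW.
    have s0 : 0 < Num.sqrt k%:R :> R by rewrite sqrtr_gt0.
    rewrite /r2; move: (Num.sqrt k%:R) (Num.sqrt d%:R) sq sqd s0 => s v <- <- s0.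
    by field; rewrite !gt_eqF.
  have chik : k%:R * chi <= eps ^+ 2 / 2.
    rewrite mulrC; apply: (@le_trans _ _ (r ^+ 2 * alpha ^+ 2 / (2 * d%:R) * k%:R)).
      by rewrite ler_pM2r.
    rewrite rE mulrAC r2E (_ : _ / _ = eps ^+ 2 / 2)//; field; lra.
  have tv : chi2_dom (power_prob (mixture Q hp) k) (power_prob (mixture Q hu) k) (1 + eps ^+ 2).
    move=> g bg; apply: (le_trans (domk _ bg)).
    rewrite ler_wpM2r ?mean_ge0// => [x|]; first exact: sqr_ge0.
    rewrite (le_trans (expr_1D_le _ chi0))//.
    apply: (@le_trans _ _ (expR (eps ^+ 2 / 2))); first by rewrite ler_expR.
    by apply: expR_half_le; apply/andP; split; nra.
  have := contaminated_two_point n1 e0 nE (fun A mA => chi2_dom_tv e0 tv mA) (mA p) (mA u) Apu.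
  set x := inner_prob _ _; set y := inner_prob _ _ => xy.
  have [x4|x4] := leP ((1 / 4)%:E : \bar R) x.
    exists p, hp; apply: (le_trans _ (inner_probS _ (@evS p))).
    apply: le_trans x4; rewrite lee_fin; lra.
  exists u, hu; apply: (le_trans _ (inner_probS _ (@evS u))).
  rewrite leNgt; apply/negP => y4.
  have : (x + y < (1 / 4)%:E + (1 / 4)%:E)%E.
    rewrite lteD//; apply: lt_le_trans y4 _; rewrite lee_fin; lra.
  by rewrite ltNge => /negP; apply; apply: le_trans xy; rewrite -EFinD lee_fin; lra.
Qed.
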